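(* There is a family of nonzero vectors $T_E\in\mathcal{P}_{m,0}$, indexed by $E\in\mathcal{E}_0$, such that $\omega_iT_E=c(i,E)T_E$ for all $E\in\mathcal{E}_0$ and $1\le i\le N$, and such that whenever $E\in\mathcal{E}_0$, $i\notin E$ and $i+1\in E\setminus\{N\}$, $$T_{s_iE}=s_iT_E-\bigl(c(i,E)-c(i+1,E)\bigr)^{-1}T_E .$$
   Context: Fix integers $N\ge2$, $1\le m\le N-1$. The anticommuting variables $\theta_1,\dots,\theta_N$ satisfy $\theta_i\theta_j=-\theta_j\theta_i$ for all $i,j$ (so $\theta_i^2=0$); coefficients are real. For $E=\{i_1<\dots<i_r\}\subset\{1,\dots,N\}$, $\phi_E=\theta_{i_1}\cdots\theta_{i_r}$, $E^C$ is the complement of $E$ in $\{1,\dots,N\}$, and $s(j,E)=\#\{i\in E:i>j\}$. $\mathcal{S}_N$ acts by algebra automorphisms with $w\theta_i=\theta_{w(i)}$; $s_i=(i,i+1)$, and $s_iE$ is the image of the set $E$. The Jucys–Murphy elements are $\omega_i=\sum_{j=i+1}^N(i,j)$, $1\le i\le N$ ($\omega_N=0$). For $\#E=m+1$, $\psi_E=\sum_{j\in E}(-1)^{s(j,E)}\phi_{E\setminus\{j\}}$, and $\mathcal{P}_{m,0}=\mathrm{span}\{\psi_E:\#E=m+1\}$. $\mathcal{E}_0=\{E:\#E=m+1,\ N\in E\}$. For $E\in\mathcal{E}_0$ the content vector is $c(i,E)=-s(i,E)$ if $i\in E$ and $c(i,E)=s(i,E^C)+1$ if $i\notin E$. *)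

(* Defs.v *)
From HB Require Import structures.
From mathcomp Require Import all_boot all_order all_algebra all_fingroup.
From mathcomp Require Import reals ring.

Set Implicit Arguments.
Unset Strict Implicit.
Unset Printing Implicit Defensive.

Import Order.TTheory GRing.Theory Num.Theory.
Local Open Scope ring_scope.

(* The algebra generated by anticommuting theta_1, ..., theta_N: an element is
   the family of its coordinates in the basis of the increasing monomials
   phi_E.  Variables are numbered from 0, so i : 'I_N stands for the index i+1. *)
Definition extalg (R : fieldType) (N : nat) := {ffun {set 'I_N} -> R^o}.

HB.instance Definition _ (R : fieldType) (N : nat) :=
  Vector.copy (extalg R N) {ffun {set 'I_N} -> R^o}.

Section Multiplication.
Variables (R : fieldType) (N : nat).
Implicit Types (A B C E F : {set 'I_N}) (p q r : extalg R N) (i j : 'I_N).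
Local Notation ext := (extalg R N).

Definition inversions A B : nat := \sum_(a in A) #|[set b in B | (b < a)%N]|.

Lemma inversions0l B : inversions set0 B = 0%N.
Proof. by rewrite /inversions big_set0. Qed.

Lemma inversions0r A : inversions A set0 = 0%N.
Proof.
rewrite /inversions big1 // => a _; apply/eqP; rewrite cards_eq0.
by apply/eqP/setP => b; rewrite !inE.
Qed.

Lemma inversionsUl A B C : [disjoint A & B] ->
  inversions (A :|: B) C = (inversions A C + inversions B C)%N.
Proof.
move=> dAB; rewrite /inversions -bigU //=.
by apply: eq_bigl => a; rewrite !inE.
Qed.

Lemma inversionsUr A B C : [disjoint B & C] ->
  inversions A (B :|: C) = (inversions A B + inversions A C)%N.
Proof.
move=> dBC; rewrite /inversions -big_split; apply: eq_bigr => a _ /=.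
rewrite -cardsUI [X in (_ + X)%N](_ : _ = 0%N) ?addn0.
  by apply: eq_card => b; rewrite !inE andb_orl.
apply/eqP; rewrite cards_eq0; apply/eqP/setP => b; rewrite !inE.
by have [bB|] //= := boolP (b \in B); rewrite (disjointFr dBC bB) andbF.
Qed.

Lemma setU_setDK A B : B \subset A -> B :|: (A :\: B) = A.
Proof. by move=> BA; rewrite -{1}(setIidPr BA) setID. Qed.

(* phi_A phi_B = (-1)^(inversions A B) phi_(A u B) for disjoint A and B, and
   phi_A phi_B = 0 otherwise *)
Definition ext_mul p q : ext :=
  [ffun E : {set 'I_N} => \sum_(A : {set 'I_N} | A \subset E)
     (-1) ^+ inversions A (E :\: A) * (p A * q (E :\: A))].

Definition ext_one : ext := [ffun E : {set 'I_N} => (E == set0)%:R].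

Fact ext_mul1l : left_id ext_one ext_mul.
Proof.
move=> p; apply/ffunP => E; rewrite !ffunE (bigD1 set0) ?sub0set //=.
rewrite !ffunE eqxx inversions0l setD0 expr0 !mul1r big1 ?addr0 // => A.
by case/andP=> _ /negPf A0; rewrite ffunE A0 mul0r mulr0.
Qed.

Fact ext_mul1r : right_id ext_one ext_mul.
Proof.
move=> p; apply/ffunP => E; rewrite !ffunE (bigD1 E) //=.
rewrite !ffunE setDv eqxx inversions0r expr0 mul1r mulr1 big1 ?addr0 // => A.
case/andP=> AE nAE; rewrite ffunE setD_eq0.
by move: nAE; rewrite eqEsubset AE /= => /negPf->; rewrite !mulr0.
Qed.

Fact ext_mulDl : left_distributive ext_mul +%R.
Proof.
move=> p q r; apply/ffunP => E; rewrite !ffunE -big_split /=.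
by apply: eq_bigr => A _; rewrite !ffunE mulrDl mulrDr.
Qed.

Fact ext_mulDr : right_distributive ext_mul +%R.
Proof.
move=> p q r; apply/ffunP => E; rewrite !ffunE -big_split /=.
by apply: eq_bigr => A _; rewrite !ffunE mulrDr mulrDr.
Qed.

Fact ext_mulA : associative ext_mul.
Proof.
move=> p q r; apply/ffunP => E; rewrite !ffunE.
pose G B A := (-1) ^+ inversions B (E :\: B) * (p B *
  ((-1) ^+ inversions (A :\: B) (E :\: A) * (q (A :\: B) * r (E :\: A)))).
transitivity (\sum_(B : {set 'I_N} | B \subset E)
    \sum_(A : {set 'I_N} | (B \subset A) && (A \subset E)) G B A).
  apply: eq_bigr => B BE; rewrite ffunE mulr_sumr mulr_sumr.
  rewrite (reindex_onto (fun A => A :\: B) (fun C => B :|: C)) /=; last first.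
    move=> C /subsetDP[_ dCB]; rewrite setDUl setDv set0U.
    by apply/setDidPl.
  apply: eq_big => [A|A /andP[AE /eqP BA]].
    apply/andP/andP => [[AE /eqP <-]|[BA AE]].
      split; first exact: subsetUl.
      by rewrite subUset BE; apply: subset_trans AE (subsetDl _ _).
    by rewrite setSD // setU_setDK.
  rewrite /G setDDl BA; congr (_ * (_ * (_ * (_ * _)))).
rewrite (exchange_big_dep (fun A : {set 'I_N} => A \subset E)) /=; last first.
  by move=> B A BE /andP[].
apply: eq_bigr => A AE; rewrite ffunE mulr_suml mulr_sumr.
apply: eq_big => [B|B /andP[BE /andP[BA _]]].
  rewrite AE andbT andb_idl // => BA; exact: subset_trans BA AE.
have dE : [disjoint A :\: B & E :\: A].
  apply/pred0P => x /=; rewrite !inE; case: (x \in A) => //=; by rewrite andbF.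
have dB : [disjoint B & A :\: B].
  by apply/pred0P => x /=; rewrite !inE; case: (x \in B).
have eE : E :\: B = (A :\: B) :|: (E :\: A).
  apply/setP => x; rewrite !inE; move/subsetP/(_ x)/implyP: BA.
  move/subsetP/(_ x)/implyP: AE.
  by case: (x \in A); case: (x \in B); case: (x \in E).
have -> : inversions A (E :\: A) =
    (inversions B (E :\: A) + inversions (A :\: B) (E :\: A))%N.
  by rewrite -inversionsUl ?setU_setDK.
rewrite /G eE inversionsUr // !exprD; ring.
Qed.

Fact ext_oner_neq0 : ext_one != 0.
Proof.
apply/eqP => /ffunP /(_ set0); rewrite !ffunE eqxx => /eqP.
by rewrite oner_eq0.
Qed.

Fact ext_scalerAl (a : R) p q : a *: ext_mul p q = ext_mul (a *: p) q.
Proof.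
apply/ffunP => E; rewrite !ffunE scaler_sumr; apply: eq_bigr => A _.
by rewrite ffunE /= /GRing.scale /= mulrCA !mulrA.
Qed.

Fact ext_scalerAr (a : R) p q : a *: ext_mul p q = ext_mul p (a *: q).
Proof.
apply/ffunP => E; rewrite !ffunE scaler_sumr; apply: eq_bigr => A _.
by rewrite ffunE /= /GRing.scale /= mulrCA; congr (_ * _); rewrite mulrCA.
Qed.

End Multiplication.

HB.instance Definition _ (R : fieldType) (N : nat) :=
  GRing.Zmodule_isNzRing.Build (extalg R N)
    (@ext_mulA R N) (@ext_mul1l R N) (@ext_mul1r R N)
    (@ext_mulDl R N) (@ext_mulDr R N) (ext_oner_neq0 R N).
HB.instance Definition _ (R : fieldType) (N : nat) :=
  GRing.Lmodule_isLalgebra.Build R (extalg R N) (@ext_scalerAl R N).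
HB.instance Definition _ (R : fieldType) (N : nat) :=
  GRing.Lalgebra_isAlgebra.Build R (extalg R N) (@ext_scalerAr R N).

Section ExteriorAlgebra.
Variables (R : fieldType) (N : nat).
Implicit Types (A B C E F : {set 'I_N}) (p q r : extalg R N) (i j : 'I_N).
Local Notation ext := (extalg R N).

Definition theta i : ext := [ffun E : {set 'I_N} => (E == [set i])%:R].

(* enum E lists E in increasing order *)
Definition phi E : ext := \prod_(i <- enum E) theta i.

Lemma ext_mulE p q E : (p * q) E = \sum_(A : {set 'I_N} | A \subset E)
  (-1) ^+ inversions A (E :\: A) * (p A * q (E :\: A)).
Proof. exact: ffunE. Qed.

Lemma theta_mulE i p E : (theta i * p) E =
  if i \in E then (-1) ^+ #|[set k in E | (k < i)%N]| * p (E :\ i) else 0.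
Proof.
rewrite ext_mulE; case: ifPn => iE; last first.
  rewrite big1 // => A AE; rewrite ffunE; case: eqP => [eA|_]; last first.
    by rewrite mul0r mulr0.
  by move: AE iE; rewrite eA sub1set => ->.
rewrite (bigD1 [set i]) ?sub1set //= ffunE eqxx mul1r big1 ?addr0.
  rewrite /inversions big_set1; congr (_ ^+ _ * _).
  apply: eq_card => k; rewrite !inE.
  by have [->|] //= := eqVneq k i; rewrite ltnn andbF.
by move=> A /andP[_ /negPf nA]; rewrite ffunE nA mul0r mulr0.
Qed.

Lemma theta_sqr i : theta i * theta i = 0.
Proof.
apply/ffunP => E; rewrite [RHS]ffunE theta_mulE; case: ifP => // iE.
rewrite ffunE; case: eqP => [/setP/(_ i)|_]; last by rewrite mulr0.
by rewrite !inE eqxx.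
Qed.

Lemma theta_anticomm i j : theta i * theta j = - (theta j * theta i).
Proof.
wlog ij : i j / (i < j)%N => [H|].
  have [ij|ji|/val_inj ->] := ltngtP i j; first exact: H.
    by rewrite (H _ _ ji) opprK.
  by rewrite theta_sqr oppr0.
have nij : i != j by rewrite neq_ltn ij.
apply/ffunP => E; rewrite [RHS]ffunE !theta_mulE !ffunE.
have [->|nE] := eqVneq E [set i; j].
  rewrite !inE !eqxx orbT /=.
  have -> : [set i; j] :\ i = [set j].
    by apply/setP => k; rewrite !inE; have [->|] := eqVneq k i; rewrite ?(negPf nij).
  have -> : [set i; j] :\ j = [set i].
    apply/setP => k; rewrite !inE; have [->|] /= := eqVneq k j; last by rewrite orbF.
    by rewrite eq_sym (negPf nij).
  rewrite !eqxx (_ : #|_| = 0%N); last first.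
    apply/eqP; rewrite cards_eq0; apply/eqP/setP => k; rewrite !inE.
    apply/negP => /andP[/orP[]/eqP-> ]; first by rewrite ltnn.
    by rewrite ltnNge ltnW.
  rewrite (_ : #|_| = 1%N) ?expr0 ?expr1 ?mulr1 ?opprK //.
  rewrite -(cards1 i); apply: eq_card => k; rewrite !inE.
  have [->|] /= := eqVneq k i; first by rewrite ij.
  by have [->|] //= := eqVneq k j; rewrite ltnn.
have H x y : [set x; y] = [set i; j] -> x \in E -> E :\ x == [set y] = false.
  move=> exy xE; apply/negP => /eqP Ex; case/eqP: nE.
  by rewrite -(setD1K xE) Ex.
by do 2 case: ifP => ?; rewrite ?H ?mulr0 ?oppr0 // setUC.
Qed.

Lemma enum_ord_sorted E : sorted (fun i j => (i < j)%N) (enum E).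
Proof.
rewrite /enum_mem; apply: sorted_filter; first by move=> ? ? ?; apply: ltn_trans.
rewrite -enumT -(@sorted_map _ _ val ltn) val_enum_ord.
exact: iota_ltn_sorted.
Qed.

Lemma enum_ordU A B : {in A & B, forall a b : 'I_N, (a < b)%N} ->
  enum (A :|: B) = enum A ++ enum B.
Proof.
move=> AB; apply: (@irr_sorted_eq _ (fun i j : 'I_N => (i < j)%N)).
- by move=> ? ? ?; apply: ltn_trans.
- by move=> ?; rewrite ltnn.
- exact: enum_ord_sorted.
- have:= enum_ord_sorted B; have:= enum_ord_sorted A.
  have: {in enum A & enum B, forall a b : 'I_N, (a < b)%N}.
    by move=> a b; rewrite !mem_enum; apply: AB.
  elim: (enum A) => //= a s IHs sB.
  rewrite !(path_sortedE (fun _ _ _ => @ltn_trans _ _ _)).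
  case/andP=> sa ss tt; rewrite all_cat sa IHs ?andbT //.
    by apply/allP => b; apply: sB; rewrite inE eqxx.
  by move=> x y xs; apply: sB; rewrite inE xs orbT.
- by move=> x; rewrite mem_cat !mem_enum inE.
Qed.

Section AnticommutingFamily.
Variable t : 'I_N -> ext.
Hypothesis tt0 : forall i, t i * t i = 0.
Hypothesis ttN : forall i j, t i * t j = - (t j * t i).

Let mul_prod i (s : seq 'I_N) :
  t i * \prod_(k <- s) t k = (-1) ^+ size s *: (\prod_(k <- s) t k * t i).
Proof.
elim: s => [|k s IHs]; first by rewrite big_nil mul1r mulr1 scale1r.
rewrite !big_cons mulrA ttN mulNr -[t k * t i * _]mulrA IHs -scalerAr /=.
by rewrite exprS mulN1r scaleNr mulrA.
Qed.

Lemma mul_prod_enum i E : t i * \prod_(k <- enum E) t k =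
  if i \in E then 0 else
    (-1) ^+ #|[set k in E | (k < i)%N]| *: \prod_(k <- enum (i |: E)) t k.
Proof.
set L := [set k in E | (k < i)%N]; set G := [set k in E | (i < k)%N].
have prodU A B : {in A & B, forall a b : 'I_N, (a < b)%N} ->
    \prod_(k <- enum (A :|: B)) t k
      = \prod_(k <- enum A) t k * \prod_(k <- enum B) t k.
  by move=> AB; rewrite enum_ordU // big_cat.
have prod1 : \prod_(k <- enum [set i]) t k = t i by rewrite enum_set1 big_seq1.
have LG : {in L & G, forall a b : 'I_N, (a < b)%N}.
  move=> a b; rewrite !inE => /andP[_ ai] /andP[_ ib]; exact: ltn_trans ai ib.
have LiG : {in L & i |: G, forall a b : 'I_N, (a < b)%N}.
  move=> a b; rewrite !inE => /andP[_ ai] /orP[/eqP->//|/andP[_ ib]].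
  exact: ltn_trans ai ib.
have iG : {in [set i] & G, forall a b : 'I_N, (a < b)%N}.
  by move=> a b; rewrite !inE => /eqP-> /andP[].
have eiE : i |: E = L :|: (i |: G).
  apply/setP => k; rewrite !inE; have [->|] := eqVneq k i; first by rewrite orbT.
  by rewrite -val_eqE /=; case: ltngtP => //=; rewrite ?andbT ?andbF ?orbF ?orFb.
case: ifPn => iE.
  have -> : E = i |: E by apply/esym/setUidPr; rewrite sub1set.
  rewrite eiE !prodU // prod1 mulrA mul_prod -scalerAl mulrA -[_ * t i * t i]mulrA.
  by rewrite tt0 mulr0 mul0r scaler0.
have {1}-> : E = L :|: G.
  apply/setP => k; rewrite !inE; have [->|] := eqVneq k i.
    by rewrite (negPf iE).
  by rewrite -val_eqE /=; case: ltngtP => //=; rewrite ?andbT ?andbF ?orbF ?orFb.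
by rewrite eiE !prodU // prod1 mulrA mul_prod -scalerAl -mulrA -cardE.
Qed.

End AnticommutingFamily.

Lemma phiE E F : phi E F = (F == E)%:R.
Proof.
rewrite /phi -{2}(set_enum E); elim: (enum E) (enum_ord_sorted E) F => [|i s IHs].
  by move=> _ F; rewrite big_nil ffunE set_nil.
rewrite /= (path_sortedE (fun _ _ _ => @ltn_trans _ _ _)) => /andP[/allP sa ss] F.
have is0 : i \notin s by apply/negP => /sa /=; rewrite ltnn.
rewrite big_cons theta_mulE set_cons; case: ifPn => iF; last first.
  by case: eqP iF => // ->; rewrite setU11.
rewrite IHs // -(setD1K iF) setU1K ?setD11 //.
have [->|nF] := eqVneq (F :\ i) [set x in s].
  rewrite eqxx mulr1 (_ : #|_| = 0%N) //; apply/eqP; rewrite cards_eq0.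
  apply/eqP/setP => k; rewrite !inE; have [->|_] := eqVneq k i; rewrite ?ltnn //=.
  by apply/negP => /andP[/sa /= ik]; rewrite ltnNge ltnW.
rewrite mulr0; case: eqP => // /(congr1 (fun A => A :\ i)) eF.
by case/eqP: nF; rewrite !setU1K ?inE ?eqxx // in eF.
Qed.

Lemma ext_decomp p : p = \sum_E p E *: phi E.
Proof.
apply/ffunP => F; rewrite sum_ffunE (bigD1 F) //= big1 ?addr0.
  by rewrite ffunE phiE eqxx /GRing.scale /= mulr1.
by move=> E nE; rewrite ffunE phiE eq_sym (negPf nE) /GRing.scale /= mulr0.
Qed.

Definition sym_act (w : 'S_N) p : ext :=
  \sum_(E : {set 'I_N}) p E *: \prod_(i <- enum E) theta (w i).

Fact sym_act_is_linear w : linear (sym_act w).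
Proof.
move=> a p q; rewrite /sym_act scaler_sumr -big_split /=; apply: eq_bigr => E _.
by rewrite !ffunE scalerDl scalerA.
Qed.

End ExteriorAlgebra.

HB.instance Definition _ (R : fieldType) (N : nat) (w : 'S_N) :=
  GRing.isLinear.Build R (extalg R N) (extalg R N) _ (@sym_act R N w)
    (@sym_act_is_linear R N w).

Section Action.
Variables (R : fieldType) (N : nat).
Implicit Types (E F : {set 'I_N}) (p q : extalg R N) (i j : 'I_N) (w : 'S_N).
Local Notation theta := (theta R).
Local Notation phi := (phi R).

Lemma sym_act_phi w E : sym_act w (phi E) = \prod_(i <- enum E) theta (w i).
Proof.
rewrite /sym_act (bigD1 E) //= [X in _ + X]big1 ?addr0 => [|F nF]; first by rewrite phiE eqxx scale1r.
by rewrite phiE (negPf nF) scale0r.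
Qed.

Lemma sym_act_theta w i : sym_act w (theta i) = theta (w i).
Proof.
have -> : theta i = phi [set i] by rewrite /phi enum_set1 big_seq1.
by rewrite sym_act_phi enum_set1 big_seq1.
Qed.

Lemma sym_act_theta_mul w i p : sym_act w (theta i * p) = theta (w i) * sym_act w p.
Proof.
rewrite [p]ext_decomp mulr_sumr !linear_sum mulr_sumr; apply: eq_bigr => E _.
rewrite -scalerAr !linearZ /= -scalerAr; congr (_ *: _).
have tt i0 j0 := theta_anticomm R (w i0) (w j0).
rewrite {1}/phi (mul_prod_enum (@theta_sqr R N) (@theta_anticomm R N)) sym_act_phi.
rewrite (mul_prod_enum (fun i0 => theta_sqr R (w i0)) tt).
by case: ifP => _; rewrite ?linear0 // linearZ /= -sym_act_phi.
Qed.

Fact sym_act_is_monoid_morphism w : monoid_morphism (@sym_act R N w).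
Proof.
have phi0 : 1 = phi (@set0 'I_N) by rewrite /phi enum_set0 big_nil.
split=> [|p q]; first by rewrite {1}phi0 sym_act_phi enum_set0 big_nil.
rewrite {1}[p]ext_decomp mulr_suml linear_sum {2}/sym_act mulr_suml.
apply: eq_bigr => E _; rewrite -!scalerAl linearZ /=; congr (_ *: _).
rewrite /phi; elim: (enum E) => [|i s IHs]; first by rewrite !big_nil !mul1r.
by rewrite !big_cons -!mulrA sym_act_theta_mul IHs.
Qed.

End Action.

HB.instance Definition _ (R : fieldType) (N : nat) (w : 'S_N) :=
  GRing.isMonoidMorphism.Build (extalg R N) (extalg R N) (@sym_act R N w)
    (@sym_act_is_monoid_morphism R N w).

Section JucysMurphy.
Variables (R : fieldType) (N : nat).
Implicit Types (E : {set 'I_N}) (p : extalg R N) (i j : 'I_N) (w : 'S_N).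

Lemma sym_act1 p : sym_act 1%g p = p.
Proof.
rewrite {2}[p]ext_decomp /sym_act; apply: eq_bigr => E _; congr (_ *: _).
by apply: eq_bigr => i _; rewrite perm1.
Qed.

(* (u * v)%g is u followed by v *)
Lemma sym_actM (u v : 'S_N) p : sym_act (u * v)%g p = sym_act v (sym_act u p).
Proof.
rewrite [sym_act u p]/sym_act linear_sum; apply: eq_bigr => E _; rewrite linearZ /=.
rewrite rmorph_prod; congr (_ *: _); apply: eq_bigr => i _ /=.
by rewrite sym_act_theta permM.
Qed.

Definition nafter j E : nat := #|[set i in E | (j < i)%N]|.

Definition psi E : extalg R N := \sum_(j in E) (-1) ^+ nafter j E *: phi R (E :\ j).

Definition psi_space (m : nat) : {vspace extalg R N} :=
  <<[seq psi E | E in [set E : {set 'I_N} | #|E| == m.+1]]>>%VS.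

Definition jucys_murphy i p : extalg R N :=
  \sum_(j : 'I_N | (i < j)%N) sym_act (tperm i j) p.

End JucysMurphy.

(* the largest index N is the i : 'I_N with i.+1 = N *)
Definition sets0 (N m : nat) : {set {set 'I_N}} :=
  [set E : {set 'I_N} | (#|E| == m.+1) && [exists i in E, i.+1 == N]].

Definition content (N : nat) (i : 'I_N) (E : {set 'I_N}) : int :=
  if i \in E then - (nafter i E)%:Z else (nafter i (~: E))%:Z + 1.

(* Main.v *)
Require Import Defs.
From HB Require Import structures.
From mathcomp Require Import all_boot all_order all_algebra all_fingroup.
From mathcomp Require Import reals ring.

Import Order.TTheory GRing.Theory Num.Theory.
Local Open Scope ring_scope.

Set Implicit Arguments.
Unset Strict Implicit.
Unset Printing Implicit Defensive.

(** The vectors of the family are products of explicit linear forms.  For an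
    index k other than the last one, let u_k (below, jm_vector R k) be theta_k
    minus the average of the theta_l with l > k, and let T_E be the product, in
    increasing order, of the u_k for k in E other than the last index.

    The reason behind this choice is the branching rule.  The differences
    theta_i - theta_j span the reflection representation V, and psi_space R N m
    is its m-th exterior power inside the exterior algebra.  When the first
    variable is dropped, V splits as the line of u_1 plus the reflection
    representation of the remaining variables, so the exterior power splits as
    the part containing the factor u_1 and the part without it.  Iterating, the
    Gelfand-Tsetlin basis consists of the monomials in the u_k, and the set E
    records which factors occur.  With the coefficient of theta_k in u_k equal
    to 1 the recursion of the theorem holds without any rescaling.

    Four facts make this into a proof.

    - T_E is nonzero since u_k is unitriangular in the theta's: the coordinate
      of T_E at its leading monomial is 1 (jm_product_neq0).

    - T_E lies in psi_space.  Up to sign, psi_E is the image of phi_E under the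
      antiderivation d with d theta_i = 1.  It kills every u_k, hence T_E, so
      T_E = d (theta_1 T_E) (jm_product_psi_space).

    - The transposition s = (i, i+1) fixes every u_k with k different from i and
      i+1, and s u_(i+1) = u_i + b u_(i+1) with b = 1 / (N - i), indices being
      numbered from 1.  The difference of contents c(i,E) - c(i+1,E) equals
      N - i as soon as i is not in E and i+1 is.  This is the recursion
      (seminormal_swap, content_sub).  The same formula gives s T_E = -T_E when
      i and i+1 are both in E, and s T_E = T_E when neither is
      (seminormal_same).

    - The relation omega_i s = s omega_(i+1) + 1 carries the eigenvalue equations
      from i+1 down to i (jucys_murphy_seminormal), starting from
      omega_N = 0. *)

(** * The boundary antiderivation and the space spanned by the psi_E *)

Lemma ext_addE (R : fieldType) (N : nat) (p q : extalg R N) (E : {set 'I_N}) :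
  (p + q) E = p E + q E.
Proof. exact: ffunE. Qed.

Lemma ext_oppE (R : fieldType) (N : nat) (p : extalg R N) (E : {set 'I_N}) :
  (- p) E = - p E.
Proof. exact: ffunE. Qed.

Lemma ext_scaleE (R : fieldType) (N : nat) (a : R) (p : extalg R N)
  (E : {set 'I_N}) : (a *: p) E = a * p E.
Proof. exact: ffunE. Qed.

(** The left antiderivation sending each theta_i to 1, written in coordinates;
    on monomials it is the boundary map of the full simplex. *)
Definition boundary (R : fieldType) (N : nat) (p : extalg R N) : extalg R N :=
  [ffun F : {set 'I_N} => \sum_(j | j \notin F)
     (-1) ^+ #|[set k in F | (k < j)%N]| * p (j |: F)].

Fact boundary_is_linear (R : fieldType) (N : nat) : linear (@boundary R N).
Proof.
move=> a p q; apply/ffunP => F; rewrite !ffunE scaler_sumr -big_split.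
by apply: eq_bigr => j _; rewrite !ffunE mulrDr /GRing.scale /= mulrCA.
Qed.

HB.instance Definition _ (R : fieldType) (N : nat) :=
  GRing.isLinear.Build R (extalg R N) (extalg R N) _ (@boundary R N)
    (@boundary_is_linear R N).

Lemma boundaryE (R : fieldType) (N : nat) (p : extalg R N) (F : {set 'I_N}) :
  boundary p F = \sum_(j | j \notin F)
     (-1) ^+ #|[set k in F | (k < j)%N]| * p (j |: F).
Proof. exact: ffunE. Qed.

Lemma card_below (N : nat) (i j : 'I_N) (F : {set 'I_N}) : i \in F ->
  #|[set k in F | (k < j)%N]| = ((i < j) + #|[set k in F :\ i | (k < j)%N]|)%N.
Proof.
move=> iF; rewrite (cardsD1 i) !inE iF; congr (_ + _)%N.
by apply: eq_card => k; rewrite !inE andbA.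
Qed.

(** The antiderivation rule.  At a monomial F not containing i only the term
    that restores i survives; otherwise the term j = i gives p, and for j <> i
    the two sides differ by the sign of exchanging i and j. *)
Lemma boundary_theta_mul (R : fieldType) (N : nat) (i : 'I_N) (p : extalg R N) :
  boundary (theta R i * p) = p - theta R i * boundary p.
Proof.
apply/ffunP => F; rewrite ext_addE ext_oppE boundaryE theta_mulE.
under eq_bigr do rewrite theta_mulE.
case: ifPn => iF; last first.
  rewrite subr0 (bigD1 i) //= setU11 big1 ?addr0 => [|j /andP[jF ji]].
    rewrite (@card_below N i i (i |: F)) ?setU11 // ltnn setU1K //.
    by rewrite mulrA -expr2 sqrr_sign mul1r.
  by rewrite !inE eq_sym (negPf ji) (negPf iF) mulr0.
rewrite boundaryE [in RHS](bigD1 i) ?setD11 //= setD1K // mulrDr mulrA.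
rewrite (card_below i iF) ltnn -expr2 sqrr_sign mul1r.
rewrite opprD addrA subrr sub0r mulr_sumr -sumrN; apply: eq_big => [j|j jF].
  by rewrite !inE negb_and negbK; have [->|] := eqVneq j i; rewrite ?iF ?andbT.
have ji : j != i by apply: contraNneq jF => ->.
rewrite !inE iF orbT.
rewrite (@card_below N j i (j |: F)) ?setU11 // setU1K //.
rewrite (card_below j iF) (card_below i iF) ltnn.
have -> : (j |: F) :\ i = j |: F :\ i.
  by apply/setP => k; rewrite !inE; have [->|] := eqVneq k i;
    rewrite // eq_sym (negPf ji).
rewrite !mulrA -!exprD -mulNr; congr (_ * _); rewrite -[RHS]mulN1r -exprS.
congr (_ ^+ _); move: ji; rewrite neq_ltn => /orP[] h; rewrite h ltnNge (ltnW h) /=;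
  rewrite !add0n !add1n ?addnS ?addSn addnC ?add0n //.
Qed.

Lemma card_below_after (N : nat) (E : {set 'I_N}) (j : 'I_N) : j \in E ->
  (#|[set k in E :\ j | (k < j)%N]| + nafter j E)%N = #|E|.-1.
Proof.
move=> jE; rewrite (cardsD1 j E) jE /= /nafter -cardsUI addnC.
rewrite [X in (X + _)%N](_ : _ = 0%N) ?add0n.
  apply: eq_card => k; rewrite !inE -val_eqE /=.
  by case: ltngtP; rewrite ?andbT ?andbF ?orbF.
apply/eqP; rewrite cards_eq0; apply/eqP/setP => k; rewrite !inE.
by case: ltngtP; rewrite ?andbF.
Qed.

(** psi_E removes each variable from the right and boundary removes it from the
    left; the ratio of the two signs depends only on the size of E. *)
Lemma boundary_phi (R : fieldType) (N : nat) (E : {set 'I_N}) :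
  boundary (phi R E) = (-1) ^+ #|E|.-1 *: psi R E.
Proof.
apply/ffunP => F; rewrite ext_scaleE boundaryE /psi sum_ffunE mulr_sumr.
rewrite big_mkcond [RHS]big_mkcond; apply: eq_bigr => j _.
rewrite ext_scaleE !phiE.
have [jE|jE] := boolP (j \in E); last first.
  case: ifP => // _; case: eqP => [eE|]; last by rewrite mulr0.
  by rewrite -eE setU11 in jE.
have [->|nF] := eqVneq F (E :\ j).
  rewrite setD11 setD1K // eqxx !mulr1 -exprD -(card_below_after jE) -addnA.
  by rewrite exprD addnn -muln2 exprM sqrr_sign mulr1.
rewrite !mulr0; case: ifP => // jF; case: eqP => [eE|]; last by rewrite mulr0.
by rewrite -eE setU1K ?eqxx // jF in nF.
Qed.

Lemma boundary_psi_space (R : fieldType) (N m : nat) (p : extalg R N) :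
    (forall E : {set 'I_N}, #|E| != m.+1 -> p E = 0) ->
  boundary p \in psi_space R N m.
Proof.
move=> hp; rewrite [p]ext_decomp linear_sum; apply: memv_suml => E _.
have [cE|/hp->] := eqVneq #|E| m.+1; last by rewrite scale0r linear0 mem0v.
rewrite linearZ /= boundary_phi; do 2 apply: memvZ; apply: memv_span.
by apply/imageP; exists E; rewrite ?inE ?cE.
Qed.

(** * The linear forms u_k and their products *)

(** The inverse of 0 is 0, so at the last index this is theta itself.  Keeping
    that value makes the formula for the action of an adjacent transposition
    uniform up to the last index. *)
Definition jm_vector (R : fieldType) (N : nat) (k : 'I_N) : extalg R N :=
  theta R k - (N - k.+1)%:R^-1 *: \sum_(l : 'I_N | (k < l)%N) theta R l.

Definition jm_product (R : fieldType) (N : nat) (A : {set 'I_N}) : extalg R N :=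
  \prod_(k <- enum A) jm_vector R k.

Lemma jm_vector_mulE (R : fieldType) (N : nat) (k : 'I_N) (p : extalg R N)
    (E : {set 'I_N}) :
  (jm_vector R k * p) E = (theta R k * p) E
    - (N - k.+1)%:R^-1 * \sum_(l : 'I_N | (k < l)%N) (theta R l * p) E.
Proof.
by rewrite mulrBl ext_addE ext_oppE -scalerAl ext_scaleE mulr_suml sum_ffunE.
Qed.

Lemma theta_mul_eq0 (R : fieldType) (N n : nat) (i : 'I_N) (p : extalg R N) :
    (forall E : {set 'I_N}, #|E| != n -> p E = 0) ->
  forall E : {set 'I_N}, #|E| != n.+1 -> (theta R i * p) E = 0.
Proof.
move=> hp E cE; rewrite theta_mulE; case: ifP => // iE.
by rewrite hp ?mulr0 //; move: cE; rewrite (cardsD1 i) iE.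
Qed.

Lemma jm_product_homogeneous (R : fieldType) (N : nat) (A E : {set 'I_N}) :
  #|E| != #|A| -> jm_product R A E = 0.
Proof.
rewrite [#|A|]cardE /jm_product; elim: (enum A) E => [|k s IHs] E /= cE.
  by rewrite big_nil ffunE -cards_eq0 (negPf cE).
rewrite big_cons jm_vector_mulE (theta_mul_eq0 _ IHs) // big1 ?mulr0 ?subr0 //.
by move=> l _; rewrite (theta_mul_eq0 _ IHs).
Qed.

(** The coordinate of the product at the set A is 1: u_k involves only the
    theta_l with l >= k, so in increasing order the smallest index of A can only
    come from the leading term of the first factor. *)
Lemma jm_product_neq0 (R : fieldType) (N : nat) (A : {set 'I_N}) :
  jm_product R A != 0.
Proof.
suff lead : jm_product R A A = 1.
  by apply/eqP => A0; move: lead; rewrite A0 ffunE => /esym/eqP; rewrite oner_eq0.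
rewrite -{2}(set_enum A) /jm_product.
(* The first half ensures that replacing the leading theta of a new factor by a
   later one never reaches the leading set. *)
suff [] : (forall (E : {set 'I_N}) (x : 'I_N), x \in E ->
    all (fun k : 'I_N => (x < k)%N) (enum A) ->
      (\prod_(k <- enum A) jm_vector R k) E = 0) /\
    (\prod_(k <- enum A) jm_vector R k) [set x in enum A] = 1 by [].
elim: (enum A) (enum_ord_sorted A) => [|i s IHs] /=.
  move=> _; rewrite set_nil big_nil; split=> [E x xE _|]; last by rewrite ffunE eqxx.
  by rewrite ffunE; case: eqP xE => // ->; rewrite inE.
rewrite (path_sortedE (fun _ _ _ => @ltn_trans _ _ _)) => /andP[si ss].
have [IH0 IH1] := IHs ss.
have theta0 (E : {set 'I_N}) (x l : 'I_N) : x \in E -> x != l ->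
    all (fun k : 'I_N => (x < k)%N) s ->
    (theta R l * \prod_(k <- s) jm_vector R k) E = 0.
  move=> xE xl xs; rewrite theta_mulE; case: ifP => // _.
  by rewrite (IH0 _ x) ?mulr0 // !inE xl.
rewrite big_cons; split=> [E x xE /andP[xi xs]|].
  rewrite jm_vector_mulE (theta0 _ x) ?neq_ltn ?xi // big1 ?mulr0 ?subr0 // => l il.
  by rewrite (theta0 _ x) ?neq_ltn ?(ltn_trans xi il).
rewrite jm_vector_mulE [\sum_(l | _) _]big1 ?mulr0 ?subr0 => [|l il]; last first.
  by rewrite (theta0 _ i) ?inE ?eqxx // neq_ltn il.
rewrite theta_mulE inE mem_head set_cons setU1K ?IH1 ?mulr1.
  rewrite (_ : #|_| = 0%N) //; apply/eqP; rewrite cards_eq0.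
  apply/eqP/setP => k; rewrite !inE; have [->|_] := eqVneq k i; rewrite ?ltnn //=.
  by apply/negP => /andP[/(allP si) /= ik]; rewrite ltnNge ltnW.
by rewrite inE; apply/negP => /(allP si); rewrite /= ltnn.
Qed.

Lemma card_after (N : nat) (k : 'I_N) :
  #|[pred l : 'I_N | (k < l)%N]| = (N - k.+1)%N.
Proof.
rewrite -sum1_card -(big_mkord (fun l => k < l)%N (fun _ => 1%N)).
rewrite (big_cat_nat (n := k.+1)) //= [X in (X + _)%N]big_nat_cond big1 => [|l].
  rewrite add0n big_nat_cond (eq_bigl (fun l => (k < l < N)%N && true)).
    by rewrite -big_nat_cond sum_nat_const_nat muln1.
  by move=> l /=; rewrite andbT; case: (k < l)%N; rewrite ?andbT ?andbF.
by rewrite ltnS => /andP[/andP[_ h]]; rewrite ltnNge h.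
Qed.

(** The constant by which u_k acts in the antiderivation rule is
    1 - (N - k) / (N - k) = 0, which is where the average is used. *)
Lemma boundary_jm_vector_mul (R : numFieldType) (N : nat) (k : 'I_N)
    (p : extalg R N) : (k.+1 < N)%N ->
  boundary (jm_vector R k * p) = - (jm_vector R k * boundary p).
Proof.
move=> kN; rewrite !mulrBl -!scalerAl !mulr_suml linearB linearZ linear_sum /=.
under eq_bigr do rewrite boundary_theta_mul.
rewrite boundary_theta_mul sumrB sumr_const card_after scalerBr -scaler_nat scalerA.
rewrite mulVf ?pnatr_eq0 -?lt0n ?subn_gt0 // scale1r.
by rewrite !opprB addrC addrA subrK.
Qed.

Lemma boundary_jm_product (R : numFieldType) (N : nat) (A : {set 'I_N}) :
  {in A, forall k : 'I_N, (k.+1 < N)%N} -> boundary (jm_product R A) = 0.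
Proof.
move=> hA; have: {in enum A, forall k : 'I_N, (k.+1 < N)%N}.
  by move=> k; rewrite mem_enum; apply: hA.
rewrite /jm_product; elim: (enum A) => [|k s IHs] hs.
  rewrite big_nil; apply/ffunP => F; rewrite boundaryE ffunE big1 // => j _.
  rewrite ffunE (_ : _ == _ = false) ?mulr0 //.
  by apply/eqP => /setP/(_ j); rewrite !inE eqxx.
rewrite big_cons boundary_jm_vector_mul ?hs ?mem_head // IHs ?mulr0 ?oppr0 //.
by move=> l ls; apply: hs; rewrite inE ls orbT.
Qed.

(** A cycle p is the boundary of theta_i p for any i, the complex of boundary
    being contractible; for p homogeneous of degree m, theta_i p is homogeneous
    of degree m + 1. *)
Lemma jm_product_psi_space (R : numFieldType) (N m : nat) (A : {set 'I_N}) :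
    (0 < N)%N -> #|A| = m -> {in A, forall k : 'I_N, (k.+1 < N)%N} ->
  jm_product R A \in psi_space R N m.
Proof.
move=> N0 cA hA.
have -> : jm_product R A = boundary (theta R (Ordinal N0) * jm_product R A).
  by rewrite boundary_theta_mul boundary_jm_product // mulr0 subr0.
apply: boundary_psi_space; apply: theta_mul_eq0 => E cE.
by apply: jm_product_homogeneous; rewrite cA.
Qed.

(** * Action of an adjacent transposition *)

Lemma sym_act_tpermK (R : fieldType) (N : nat) (i j : 'I_N) :
  involutive (@sym_act R N (tperm i j)).
Proof. by move=> p; rewrite -sym_actM tperm2 sym_act1. Qed.

(** An adjacent transposition (i, i+1) preserves the set of indices above k
    unless k = i. *)
Lemma ltn_tperm (N : nat) (i j k l : 'I_N) :
  j = i.+1 :> nat -> k != i -> (k < tperm i j l)%N = (k < l)%N.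
Proof.
move=> ji; rewrite -val_eqE /= => ki; case: tpermP => // ->; rewrite ji ltnS.
  by rewrite leq_eqVlt (negPf ki).
by rewrite [RHS]leq_eqVlt (negPf ki).
Qed.

Lemma sym_act_theta_sum (R : fieldType) (N : nat) (i j k : 'I_N) :
    j = i.+1 :> nat -> k != i ->
  sym_act (tperm i j) (\sum_(l : 'I_N | (k < l)%N) theta R l) =
    \sum_(l : 'I_N | (k < l)%N) theta R l.
Proof.
move=> ji ki; rewrite linear_sum [RHS](reindex_inj (@perm_inj _ (tperm i j))) /=.
by apply: eq_big => [l|l _]; rewrite ?ltn_tperm // sym_act_theta.
Qed.

Lemma sym_act_jm_vector (R : fieldType) (N : nat) (i j k : 'I_N) :
    j = i.+1 :> nat -> k != i -> k != j ->
  sym_act (tperm i j) (jm_vector R k) = jm_vector R k.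
Proof.
move=> ji ki kj; rewrite linearB linearZ /= sym_act_theta_sum // sym_act_theta.
by rewrite tpermD 1?eq_sym.
Qed.

(** Comparing coefficients, the average over the indices above j is to be
    rewritten with the weight of those above i: if n indices lie above j, this is
    1/n = 1/(n+1) + 1/(n+1) * 1/n.  For j the last index n = 0, but then the sum
    is empty. *)
Lemma sym_act_jm_vector_right (R : numFieldType) (N : nat) (i j : 'I_N) :
    j = i.+1 :> nat ->
  sym_act (tperm i j) (jm_vector R j) =
    jm_vector R i + (N - i.+1)%:R^-1 *: jm_vector R j.
Proof.
move=> ji; have ij : j != i by rewrite -val_eqE /= ji neq_ltn ltnSn orbT.
rewrite linearB linearZ /= sym_act_theta_sum // sym_act_theta tpermR /jm_vector.
have -> : \sum_(l : 'I_N | (i < l)%N) theta R l =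
    theta R j + \sum_(l : 'I_N | (j < l)%N) theta R l.
  rewrite (bigD1 j) ?ji //=; congr (_ + _); apply: eq_bigl => l.
  by rewrite -val_eqE /= ji [RHS]ltn_neqAle andbC eq_sym.
set S := \sum_(l | _) _; set b := (N - i.+1)%:R^-1.
have tail : (N - j.+1)%:R^-1 *: S = b *: S + (b * (N - j.+1)%:R^-1) *: S.
  have [jN|jN] := ltnP j.+1 N; last first.
    rewrite (_ : S = 0) ?scaler0 ?addr0 //; apply: big1 => l; rewrite ltnNge.
    by rewrite -ltnS (leq_trans (ltn_ord l) jN).
  rewrite -scalerDl; congr (_ *: _).
  have -> : b = ((N - j.+1)%:R + 1)^-1.
    by rewrite /b natr1 -subSn // subSS -ji.
  by field; rewrite natr1 !pnatr_eq0 -lt0n subn_gt0 jN.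
rewrite scalerDr scalerBr scalerA tail [b *: theta R j + _]addrC !opprD !addrA.
by rewrite subrK.
Qed.

(** Two forms anticommute because each is a combination of the theta's;
    the exchange rule is extended linearly in one factor and then in the other. *)
Lemma jm_vector_anticomm (R : fieldType) (N : nat) (i j : 'I_N) :
  jm_vector R i * jm_vector R j = - (jm_vector R j * jm_vector R i).
Proof.
have anti k (p : extalg R N) : (forall l, p * theta R l = - (theta R l * p)) ->
    p * jm_vector R k = - (jm_vector R k * p).
  move=> hp; rewrite mulrBr mulrBl hp -scalerAr -scalerAl mulr_sumr mulr_suml.
  by rewrite (eq_bigr _ (fun l _ => hp l)) sumrN scalerN -opprD.
apply: (anti) => l; rewrite [in RHS]anti ?opprK // => k; exact: theta_anticomm.
Qed.

Lemma jm_vector_sqr (R : numFieldType) (N : nat) (i : 'I_N) :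
  jm_vector R i * jm_vector R i = 0.
Proof.
apply/eqP; have /eqP := jm_vector_anticomm R i i.
by rewrite -addr_eq0 -mulr2n -scaler_nat scaler_eq0 pnatr_eq0.
Qed.

(** The factors at i and j = i + 1 are adjacent in an increasing product, so a
    transposition of i and j acts on the middle part only. *)
Lemma jm_product_split (R : fieldType) (N : nat) (A : {set 'I_N})
    (i j : 'I_N) : j = i.+1 :> nat ->
  jm_product R A = jm_product R [set k in A | (k < i)%N]
    * jm_product R (A :&: [set i; j]) * jm_product R [set k in A | (j < k)%N].
Proof.
move=> ji.
have {1}-> : A = [set k in A | (k < i)%N] :|: A :&: [set i; j]
    :|: [set k in A | (j < k)%N].
  apply/setP => k; rewrite !inE -!val_eqE /= ji.
  by case: (k \in A) => //=; case: (ltngtP k i) => //= ik; rewrite eq_sym -leq_eqVlt.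
rewrite /jm_product -!big_cat -!enum_ordU // => a b; rewrite !inE.
  move=> aij /andP[_]; apply: leq_ltn_trans; move: aij.
  by case/orP=> [/andP[_ /ltnW/leqW]|/andP[_ /orP[]/eqP->]]; rewrite ji.
by move=> /andP[_ ai] /andP[_ /orP[]/eqP->] //; rewrite ji ltnS ltnW.
Qed.

Lemma sym_act_jm_product_fix (R : fieldType) (N : nat) (A : {set 'I_N})
    (i j : 'I_N) : j = i.+1 :> nat -> i \notin A -> j \notin A ->
  sym_act (tperm i j) (jm_product R A) = jm_product R A.
Proof.
move=> ji iA jA; rewrite /jm_product rmorph_prod /= big_seq [RHS]big_seq.
apply: eq_bigr => k; rewrite mem_enum => kA.
by rewrite sym_act_jm_vector //; apply: contraTneq kA => ->.
Qed.

Lemma sym_act_jm_product_split (R : fieldType) (N : nat) (A : {set 'I_N})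
    (i j : 'I_N) : j = i.+1 :> nat ->
  sym_act (tperm i j) (jm_product R A) = jm_product R [set k in A | (k < i)%N]
    * sym_act (tperm i j) (jm_product R (A :&: [set i; j]))
    * jm_product R [set k in A | (j < k)%N].
Proof.
move=> ji; rewrite (jm_product_split R A ji) !rmorphM /=.
rewrite (@sym_act_jm_product_fix _ _ [set k in A | (k < i)%N] _ _ ji).
- rewrite (@sym_act_jm_product_fix _ _ [set k in A | (j < k)%N] _ _ ji) // !inE ji.
    by rewrite ltnNge leqnSn andbF.
  by rewrite ltnn andbF.
- by rewrite inE ltnn andbF.
- by rewrite inE ji ltnNge leqnSn andbF.
Qed.

Lemma mem_tperm_imset (T : finType) (x y z : T) (A : {set T}) :
  (z \in tperm x y @: A) = (tperm x y z \in A).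
Proof. by rewrite -{1}[z](tpermK x y) mem_imset //; apply: perm_inj. Qed.

Lemma sym_act_jm_product_right (R : numFieldType) (N : nat) (A : {set 'I_N})
    (i j : 'I_N) :
    j = i.+1 :> nat -> i \notin A -> j \in A ->
  sym_act (tperm i j) (jm_product R A) =
    jm_product R (tperm i j @: A) + (N - i.+1)%:R^-1 *: jm_product R A.
Proof.
move=> ji iA jA; rewrite sym_act_jm_product_split //.
rewrite (jm_product_split R A ji) (jm_product_split R (_ @: A) ji).
have -> : A :&: [set i; j] = [set j].
  apply/setP => k; rewrite !inE; have [->|_] := eqVneq k j; first by rewrite jA orbT.
  by rewrite orbF; case: eqP => [->|]; rewrite ?(negPf iA) ?andbF.
have -> : tperm i j @: A :&: [set i; j] = [set i].
  apply/setP => k; rewrite !inE mem_tperm_imset.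
  have [->|ki] := eqVneq k i; first by rewrite tpermL jA.
  by case: eqP => [->|]; rewrite ?tpermR ?(negPf iA) ?andbF.
have -> : [set k in tperm i j @: A | (k < i)%N] = [set k in A | (k < i)%N].
  apply/setP => k; rewrite !inE mem_tperm_imset.
  by case: tpermP => // ->; rewrite ?ji ltnNge ?leqnn ?leqnSn ?andbF.
have -> : [set k in tperm i j @: A | (j < k)%N] = [set k in A | (j < k)%N].
  apply/setP => k; rewrite !inE mem_tperm_imset.
  by case: tpermP => // ->; rewrite ?ji ltnNge ?leqnn ?leqnSn ?andbF.
rewrite /jm_product !enum_set1 !big_seq1 sym_act_jm_vector_right //.
by rewrite mulrDr mulrDl -scalerAr -scalerAl.
Qed.

(** Obtained from sym_act_jm_vector_right by applying the involution once more. *)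
Lemma sym_act_jm_vector_left (R : numFieldType) (N : nat) (i j : 'I_N) :
    j = i.+1 :> nat -> let b := (N - i.+1)%:R^-1 in
  sym_act (tperm i j) (jm_vector R i) =
    (1 - b ^+ 2) *: jm_vector R j - b *: jm_vector R i.
Proof.
move=> ji b; have sj := sym_act_jm_vector_right R ji; rewrite -/b in sj.
have := sym_act_tpermK i j (jm_vector R j).
rewrite {1}sj linearD linearZ /= sj => /(canRL (addrK _)) ->.
by rewrite scalerDr scalerA -expr2 scalerBl scale1r opprD addrA addrAC.
Qed.

(** On the plane spanned by the two forms the transposition is a reflection, so
    it acts by its determinant -1 on their product. *)
Lemma sym_act_jm_product_both (R : numFieldType) (N : nat) (A : {set 'I_N})
    (i j : 'I_N) : j = i.+1 :> nat -> i \in A -> j \in A ->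
  sym_act (tperm i j) (jm_product R A) = - jm_product R A.
Proof.
move=> ji iA jA; rewrite sym_act_jm_product_split // (jm_product_split R A ji).
have -> : A :&: [set i; j] = [set i; j].
  by apply/setIidPr; rewrite subUset !sub1set iA jA.
rewrite -mulNr -mulrN; congr (_ * _ * _).
rewrite /jm_product enum_ordU => [|a b]; last first.
  by rewrite !inE => /eqP-> /eqP->; rewrite ji.
rewrite !enum_set1 !big_cons !big_nil !mulr1 rmorphM /=.
rewrite sym_act_jm_vector_right // sym_act_jm_vector_left //=; set b := _^-1.
rewrite mulrDr 2!mulrBl -!scalerAr -!scalerAl !jm_vector_sqr !scaler0 subr0 sub0r.
rewrite (jm_vector_anticomm R j i) scalerN scalerBl scale1r scalerA -expr2 opprB.
by rewrite addrC addKr.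
Qed.

(** Here 1 / (N - i) is 1 for the index i preceding the last one, so the first
    coefficient of sym_act_jm_vector_left vanishes: that form is a difference of
    two theta's. *)
Lemma sym_act_jm_product_last (R : numFieldType) (N : nat) (A : {set 'I_N})
    (i j : 'I_N) : j = i.+1 :> nat -> j.+1 = N -> i \in A -> j \notin A ->
  sym_act (tperm i j) (jm_product R A) = - jm_product R A.
Proof.
move=> ji jN iA jA; rewrite sym_act_jm_product_split // (jm_product_split R A ji).
have -> : A :&: [set i; j] = [set i].
  apply/setP => k; rewrite !inE; have [->|_] := eqVneq k i; first by rewrite iA.
  by rewrite orFb; case: eqP => [->|]; rewrite ?(negPf jA) ?andbF.
rewrite -mulNr -mulrN; congr (_ * _ * _).
rewrite /jm_product enum_set1 !big_seq1 sym_act_jm_vector_left //=.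
have -> : (N - i.+1 = 1)%N by rewrite -ji -{1}jN subSnn.
by rewrite invr1 expr1n subrr scale0r sub0r scale1r.
Qed.

(** * Contents and the Jucys-Murphy eigenvalues *)

Fact jucys_murphy_is_linear (R : fieldType) (N : nat) (i : 'I_N) :
  linear (@jucys_murphy R N i).
Proof.
move=> a p q; rewrite /jucys_murphy scaler_sumr -big_split /=.
by apply: eq_bigr => j _; rewrite linearP.
Qed.

HB.instance Definition _ (R : fieldType) (N : nat) (i : 'I_N) :=
  GRing.isLinear.Build R (extalg R N) (extalg R N) _ (@jucys_murphy R N i)
    (@jucys_murphy_is_linear R N i).

(** The degenerate Hecke relation: conjugation by (i, i+1) turns the
    transpositions (i, k) with k > i+1 into (i+1, k), and the remaining one,
    (i, i+1), squares to the identity. *)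
Lemma jucys_murphy_sym_act (R : fieldType) (N : nat) (i j : 'I_N) (p : extalg R N) :
    j = i.+1 :> nat ->
  jucys_murphy i (sym_act (tperm i j) p) =
    sym_act (tperm i j) (jucys_murphy j p) + p.
Proof.
move=> ji; rewrite {1}/jucys_murphy (bigD1 j) ?ji //= sym_act_tpermK addrC.
congr (_ + _); rewrite linear_sum.
have ij : j != i by rewrite -val_eqE /= ji neq_ltn ltnSn orbT.
apply: eq_big => [k|k /andP[ik kj]].
  by rewrite -val_eqE /= ji [RHS]ltn_neqAle andbC eq_sym.
rewrite /= -!sym_actM; congr (sym_act _ p).
rewrite -[tperm j k](conjgK (tperm i j)) tpermV tpermJ tpermR tpermD //.
- by rewrite conjgE tpermV -!mulgA tperm2 mulg1.
- by rewrite neq_ltn ik.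
- by rewrite eq_sym.
Qed.

Lemma nafterS (N : nat) (i j : 'I_N) (E : {set 'I_N}) :
  j = i.+1 :> nat -> nafter i E = ((j \in E) + nafter j E)%N.
Proof.
move=> ji; rewrite /nafter (cardsD1 j) !inE ji ltnSn andbT; congr (_ + _)%N.
apply: eq_card => k; rewrite !inE -val_eqE /= ji [in RHS]ltn_neqAle eq_sym.
by rewrite andbCA.
Qed.

Lemma nafterC (N : nat) (i : 'I_N) (E : {set 'I_N}) :
  (nafter i E + nafter i (~: E))%N = (N - i.+1)%N.
Proof.
rewrite -card_after -(cardID E) /nafter; congr (_ + _)%N; apply: eq_card => k.
  by rewrite !inE andbC.
by rewrite !inE andbC.
Qed.

Lemma contentS (N : nat) (i j : 'I_N) (E : {set 'I_N}) :
  j = i.+1 :> nat -> (i \in E) = (j \in E) ->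
  content i E = content j E + (-1) ^+ (i \in E).
Proof.
move=> ji ij; rewrite /content !(nafterS _ ji) inE -ij.
case: (i \in E) => /=; last by rewrite add1n -addn1 PoszD.
by rewrite add1n -addn1 PoszD opprD.
Qed.

(** The two contents add up the elements of the complement and of E above i,
    that is, all the indices above i. *)
Lemma content_sub (N : nat) (i j : 'I_N) (E : {set 'I_N}) :
    j = i.+1 :> nat -> i \notin E -> j \in E ->
  content i E - content j E = (N - i.+1)%N.
Proof.
move=> ji iE jE; rewrite /content (negPf iE) jE opprK (nafterS _ ji) inE jE add0n.
by rewrite -(nafterC i E) (nafterS E ji) (nafterS (~: E) ji) inE jE /= !PoszD; ring.
Qed.

Lemma nafter_imset (N : nat) (i j : 'I_N) (E F : {set 'I_N}) :
    j = i.+1 :> nat -> (forall k, (k \in F) = (tperm i j k \in E)) ->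
  nafter j F = nafter j E.
Proof.
move=> ji EF; apply: eq_card => k; rewrite !inE EF.
by case: tpermP => // ->; rewrite ?ji ltnNge ?leqnn ?leqnSn ?andbF.
Qed.

Lemma content_swap (N : nat) (i j : 'I_N) (E : {set 'I_N}) :
    j = i.+1 :> nat -> i \notin E -> j \in E ->
  content i (tperm i j @: E) = content j E /\ content j (tperm i j @: E) = content i E.
Proof.
move=> ji iE jE; rewrite /content !mem_tperm_imset tpermL tpermR (negPf iE) jE.
rewrite (nafterS (tperm i j @: E) ji) mem_tperm_imset tpermR (negPf iE).
rewrite (nafterS (~: E) ji) inE jE /= !add0n.
split; first by
  congr (- (Posz _)); apply: (nafter_imset ji) => k; rewrite mem_tperm_imset.
congr (Posz _ + 1); apply: (nafter_imset ji) => k.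
by rewrite !inE mem_tperm_imset.
Qed.

(** The last index is left out because every set of the family contains it: it
    stands for the trivial representation at the bottom of the branching. *)
Definition seminormal (R : fieldType) (N : nat) (E : {set 'I_N}) : extalg R N :=
  jm_product R [set k in E | (k.+1 < N)%N].

Lemma seminormal_swap (R : numFieldType) (N : nat) (i j : 'I_N) (E : {set 'I_N}) :
    j = i.+1 :> nat -> i \notin E -> j \in E -> j.+1 != N ->
  sym_act (tperm i j) (seminormal R E) =
    seminormal R (tperm i j @: E) + (N - i.+1)%:R^-1 *: seminormal R E.
Proof.
move=> ji iE jE jN; have jltN : (j.+1 < N)%N by rewrite ltn_neqAle jN ltn_ord.
rewrite /seminormal (sym_act_jm_product_right _ ji) ?inE ?(negPf iE) ?jE //.
rewrite (_ : tperm i j @: _ = [set k in tperm i j @: E | (k.+1 < N)%N]) //.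
apply/setP => k; rewrite mem_tperm_imset !inE mem_tperm_imset.
by case: tpermP => // ->; rewrite jltN -ji (ltnW jltN).
Qed.

(** When j is the last index it lies in E without contributing a factor, and
    the sign comes from the form at i alone. *)
Lemma seminormal_same (R : numFieldType) (N : nat) (i j : 'I_N) (E : {set 'I_N}) :
    j = i.+1 :> nat -> (i \in E) = (j \in E) ->
  sym_act (tperm i j) (seminormal R E) = (-1) ^+ (i \in E) *: seminormal R E.
Proof.
move=> ji; rewrite /seminormal; case iE: (i \in E) => /esym jE; last first.
  by rewrite expr0 scale1r (sym_act_jm_product_fix _ ji) // inE ?iE ?jE.
have iI : i \in [set k in E | (k.+1 < N)%N] by rewrite inE iE -ji ltn_ord.
rewrite expr1 scaleN1r; have [jN|jN] := eqVneq j.+1 N.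
  by rewrite (sym_act_jm_product_last _ ji) // inE jN ltnn andbF.
by rewrite (sym_act_jm_product_both _ ji) // inE jE ltn_neqAle jN ltn_ord.
Qed.

(** Downward induction on i.  If the transposition s = (i, i+1) acts on T_E by a
    sign e, then omega_i T_E = (c(i+1,E) + e) T_E.  Otherwise T_E and T_(sE) span
    an s-stable plane, on which omega_(i+1) is known to have the eigenvalues
    c(i+1,E) and c(i,E); the relation between omega_i, s and omega_(i+1) then
    shows that omega_i has these eigenvalues exchanged. *)
Lemma jucys_murphy_seminormal (R : numFieldType) (N : nat) (i : 'I_N)
    (E : {set 'I_N}) :
    (forall l : 'I_N, l.+1 = N -> l \in E) ->
  jucys_murphy i (seminormal R E) = (content i E)%:~R *: seminormal R E.
Proof.
have [n] : {n | N - i.+1 = n}%N by exists (N - i.+1)%N.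
elim: n i E => [|n IHn] i E.
  move=> /eqP; rewrite subn_eq0 => Ni lastE.
  have iE : i \in E by apply: lastE; apply/eqP; rewrite eqn_leq Ni ltn_ord.
  have below (k : 'I_N) : (i < k)%N = false.
    by apply/negbTE; rewrite -leqNgt -ltnS (leq_trans (ltn_ord k)).
  rewrite /jucys_murphy big_pred0 // /content iE /nafter.
  rewrite (_ : #|_| = 0%N) ?oppr0 ?scale0r //.
  by apply/eqP; rewrite cards_eq0; apply/eqP/setP => k; rewrite !inE below andbF.
move=> iN; have iltN : (i.+1 < N)%N by rewrite -subn_gt0 iN.
pose j := Ordinal iltN; have ji : j = i.+1 :> nat by [].
have {}IHn := IHn j; rewrite subnS iN in IHn; have {}IHn F := IHn F erefl.
have eigen (F : {set 'I_N}) (e : bool) : (forall l : 'I_N, l.+1 = N -> l \in F) ->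
    sym_act (tperm i j) (seminormal R F) = (-1) ^+ e *: seminormal R F ->
    content i F = content j F + (-1) ^+ e ->
    jucys_murphy i (seminormal R F) = (content i F)%:~R *: seminormal R F.
  move=> lastF sF cF.
  rewrite -{1}[seminormal R F](sym_act_tpermK i j) sF linearZ /= linearZ /=.
  rewrite (jucys_murphy_sym_act _ ji) IHn // linearZ /= sF cF.
  rewrite rmorphD rmorphXn rmorphN rmorph1 scalerDr !scalerA scalerDl.
  by rewrite mulrAC -expr2 sqrr_sign mul1r.
have swap (F : {set 'I_N}) : (forall l : 'I_N, l.+1 = N -> l \in F) ->
    i \notin F -> j \in F -> j.+1 != N ->
    jucys_murphy i (seminormal R F) = (content i F)%:~R *: seminormal R F /\
    jucys_murphy i (seminormal R (tperm i j @: F)) =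
      (content i (tperm i j @: F))%:~R *: seminormal R (tperm i j @: F).
  move=> lastF iF jF jN; have sF := seminormal_swap R ji iF jF jN.
  have [ci cj] := content_swap ji iF jF.
  have dc := content_sub ji iF jF.
  have lastF' (l : 'I_N) : l.+1 = N -> l \in tperm i j @: F.
    move=> lN; rewrite mem_tperm_imset tpermD ?lastF //.
      by apply: contraTneq (iltN) => ->; rewrite lN ltnn.
    by apply: contraNneq jN => ->; rewrite lN.
  have Hj := IHn _ lastF; have Hj' := IHn _ lastF'; rewrite cj in Hj'.
  set T := seminormal R F in sF Hj *; set T' := seminormal R _ in sF Hj' *.
  (* The value of content_sub, in the form that makes the terms in s T below
     cancel. *)
  have bc : (N - i.+1)%:R^-1 * (content j F)%:~R
      = (N - i.+1)%:R^-1 * (content i F)%:~R - 1 :> R.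
    apply/eqP; rewrite eq_sym subr_eq addrC -subr_eq -mulrBr -intrB dc.
    by rewrite mulVf // pnatr_eq0 iN.
  have HT : jucys_murphy i T = (content i F)%:~R *: T.
    rewrite -{1}[T](sym_act_tpermK i j) (jucys_murphy_sym_act _ ji) sF.
    rewrite linearD linearZ /= Hj Hj' scalerA bc scalerBl scale1r mulrC -scalerA.
    rewrite [X in sym_act _ X]addrA -scalerDr -sF linearB linearZ /= sym_act_tpermK.
    by rewrite subrK.
  split=> //; have -> : T' = sym_act (tperm i j) T - (N - i.+1)%:R^-1 *: T.
    by rewrite sF addrK.
  rewrite linearB linearZ /= (jucys_murphy_sym_act _ ji) HT Hj ci linearZ /=.
  rewrite scalerBr !scalerA [_ * _^-1 as X in X *: _]mulrC bc scalerBl scale1r opprB.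
  by rewrite -addrA.
move=> lastE; have [ij|] := eqVneq (i \in E) (j \in E); first by
  apply: (eigen E _ lastE (seminormal_same R ji ij) (contentS ji ij)).
have [iE|iE] := boolP (i \in E); have [jE|jE] // := boolP (j \in E) => _.
  have jN : j.+1 != N by apply: contraNneq jE => /lastE.
  have EK : tperm i j @: (tperm i j @: E) = E.
    by apply/setP => k; rewrite !mem_tperm_imset tpermK.
  rewrite -EK; apply: (proj2 (swap _ _ _ _ _)); rewrite ?mem_tperm_imset ?tpermL ?tpermR //.
  move=> l lN; rewrite mem_tperm_imset tpermD ?lastE //.
    by apply: contraTneq (iltN) => ->; rewrite lN ltnn.
  by apply: contraNneq jN => ->; rewrite lN.
have [jN|jN] := eqVneq j.+1 N; last by apply: (proj1 (swap _ _ _ _ _)).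
(* j is the last index: T_E has no factor at i or j, so s fixes it. *)
apply: (eigen E false) => //.
  rewrite expr0 scale1r /seminormal (sym_act_jm_product_fix _ ji) // inE ?(negPf iE) //.
  by rewrite jN ltnn andbF.
apply/eqP; rewrite expr0 addrC -subr_eq (content_sub ji iE jE) -ji.
by apply/eqP; congr Posz; rewrite -{1}jN subSnn.
Qed.

Lemma sets0_last (N m : nat) (E : {set 'I_N}) (l : 'I_N) :
  E \in sets0 N m -> l.+1 = N -> l \in E.
Proof.
rewrite inE => /andP[_ /exists_inP[k kE /eqP kN]] lN.
by have -> : l = k by apply/val_inj/succn_inj; rewrite lN kN.
Qed.

Lemma sets0_card (N m : nat) (E : {set 'I_N}) :
  E \in sets0 N m -> #|[set k in E | (k.+1 < N)%N]| = m.
Proof.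
rewrite inE => /andP[cE /exists_inP[l lE /eqP lN]].
apply/eqP; move: cE; rewrite (cardsD1 l) lE add1n eqSS => /eqP <-.
apply/eqP/eq_card => k; rewrite !inE andbC; congr (_ && _).
by rewrite ltn_neqAle ltn_ord andbT -[k == l]val_eqE /= -[(k : nat) == l]eqSS lN.
Qed.

Theorem theorem3 (R : realType) (N m : nat)
    (hN : (2 <= N)%N) (hm : (1 <= m <= N.-1)%N) :
  exists T : {set 'I_N} -> extalg R N,
    [/\ forall E : {set 'I_N}, E \in sets0 N m ->
          T E != 0 /\ T E \in psi_space R N m,
        forall (E : {set 'I_N}) (i : 'I_N), E \in sets0 N m ->
          jucys_murphy i (T E) = (content i E)%:~R *: T E
      & forall (E : {set 'I_N}) (i j : 'I_N), E \in sets0 N m ->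
          j = i.+1 :> nat -> i \notin E -> j \in E -> j.+1 != N ->
          T (tperm i j @: E) =
            sym_act (tperm i j) (T E)
            - ((content i E - content j E)%:~R)^-1 *: T E].
Proof.
exists (@seminormal R N); split.
- move=> E E0; split; first exact: jm_product_neq0.
  apply: jm_product_psi_space; first exact: ltnW.
    exact: sets0_card.
  by move=> k; rewrite inE => /andP[].
- by move=> E i E0; apply: jucys_murphy_seminormal => l; apply: (sets0_last E0).
- move=> E i j E0 ji iE jE jN.
  by rewrite seminormal_swap // (content_sub ji) // addrK.
Qed.
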